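(* Let $R$ be a $G$-graded commutative ring, $M$ a finitely generated graded $R$-module, $S\subseteq h(R)$ a multiplicatively closed subset, and $N$ a graded $R$-submodule of $M$ such that $(N:_RM)\cap S=\emptyset$. For $s\in S$, we have $N\in GSpec_s({}_RM)$ if and only if $S^{-1}N$ is a graded prime $S^{-1}R$-submodule of $S^{-1}M$ and $(N:_Mt)\subseteq(N:_Ms)$ for all $t\in S$.
   Context: $G$ is a group with identity $e$; rings are commutative with nonzero unity $1$ and modules are unital. A ring $R$ is $G$-graded if $R=\bigoplus_{g\in G}R_g$ with additive subgroups $R_g$ satisfying $R_gR_h\subseteq R_{gh}$; $h(R)=\bigcup_{g\in G}R_g$ and $h^*(R)=h(R)\setminus\{0\}$. An $R$-module $M$ is $G$-graded if $M=\bigoplus_{g\in G}M_g$ with additive subgroups $M_g$ satisfying $R_gM_h\subseteq M_{gh}$; $h(M)=\bigcup_{g\in G}M_g$. A submodule $N$ of $M$ is graded if $N=\bigoplus_{g\in G}(N\cap M_g)$. Write $(N:_RM)=\{r\in R: rM\subseteq N\}$ and, for $t\in R$, $(N:_Mt)=\{m\in M:tm\in N\}$. For $s\in h^*(R)$, a graded $R$-submodule $N$ of $M$ is graded $s$-prime if $s\notin(N:_RM)$ and, for all $r\in h(R)$ and $m\in h(M)$, $rm\in N$ implies $sr\in(N:_RM)$ or $sm\in N$; $GSpec_s({}_RM)$ is the set of these. A graded prime submodule is a proper graded $R$-submodule $N$ of $M$ such that for all $r\in h(R)$, $m\in h(M)$, $rm\in N$ implies $r\in(N:_RM)$ or $m\in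 N$. A multiplicatively closed subset $S$ of $R$ satisfies $0\notin S$, $1\in S$, and $st\in S$ for all $s,t\in S$. For such $S\subseteq h(R)$, $S^{-1}R$ is a graded ring with $(S^{-1}R)_g=\{\frac{a}{s}: a\in R_h,\ s\in S\cap R_{hg^{-1}}\text{ for some } h\in G\}$, and $S^{-1}M$ is a graded $S^{-1}R$-module with $(S^{-1}M)_g=\{\frac{m}{s}: m\in M_h,\ s\in S\cap R_{hg^{-1}}\text{ for some } h\in G\}$. *)

(* Defs.v *)
From HB Require Import structures.
From mathcomp Require Import all_boot all_algebra all_fingroup.
From mathcomp Require Import generic_quotient.
From mathcomp Require Import mathcomp_extra boolp classical_sets cardinality fsbigop.
From mathcomp Require Import ring.

Set Implicit Arguments.
Unset Strict Implicit.
Unset Printing Implicit Defensive.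

Import GRing.Theory.

Local Open Scope quotient_scope.
Local Open Scope classical_set_scope.
Local Open Scope ring_scope.

(* [N] is the internal direct sum of the additive subgroups [A g].  The finite
   support condition is needed because [\sum_(g \in _) _] is 0 on families with
   infinite support. *)
Definition internal_direct_sum (I : choiceType) (V : zmodType)
    (N : set V) (A : I -> set V) : Prop :=
  [/\ forall g, zmod_closed (mem (A g)),
      forall g, A g `<=` N,
      zmod_closed (mem N) &
      forall x, N x ->
        exists! f : I -> V,
          [/\ finite_set (f @^-1` [set~ 0]), forall g, A g (f g) &
              x = \sum_(g \in [set: I]) f g] ].

Definition graded_ring (G : groupType) (R : comNzRingType)
    (A : G -> set R) : Prop :=
  internal_direct_sum [set: R] A /\
  forall g h r r', A g r -> A h r' -> A (g * h)%g (r * r').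

Definition graded_module (G : groupType) (R : comNzRingType) (M : lmodType R)
    (A : G -> set R) (B : G -> set M) : Prop :=
  internal_direct_sum [set: M] B /\
  forall g h r m, A g r -> B h m -> B (g * h)%g (r *: m).

Definition homogeneous (G : groupType) (V : zmodType) (A : G -> set V) :
  set V := \bigcup_g A g.

Definition nz_homogeneous (G : groupType) (V : zmodType) (A : G -> set V) :
  set V := homogeneous A `\ 0.

Definition graded_submodule (G : groupType) (R : comNzRingType)
    (M : lmodType R) (B : G -> set M) (N : set M) : Prop :=
  submod_closed (mem N) /\ internal_direct_sum N (fun g => N `&` B g).

Definition finitely_generated (R : comNzRingType) (M : lmodType R) : Prop :=
  exists (n : nat) (x : 'I_n -> M),
    forall m : M, exists c : 'I_n -> R, m = \sum_(i < n) c i *: x i.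

(* (N :_R M) *)
Definition colon_ring (R : comNzRingType) (M : lmodType R) (N : set M) :
  set R := [set r | forall m : M, N (r *: m)].

(* (N :_M t) *)
Definition colon_mod (R : comNzRingType) (M : lmodType R) (N : set M) (t : R) :
  set M := [set m | N (t *: m)].

Definition graded_prime (G : groupType) (R : comNzRingType) (M : lmodType R)
    (A : G -> set R) (B : G -> set M) (N : set M) : Prop :=
  [/\ graded_submodule B N,
      N != [set: M] &
      forall (r : R) (m : M), homogeneous A r -> homogeneous B m ->
        N (r *: m) -> colon_ring N r \/ N m ].

Definition graded_s_prime (G : groupType) (R : comNzRingType) (M : lmodType R)
    (A : G -> set R) (B : G -> set M) (s : R) (N : set M) : Prop :=
  [/\ graded_submodule B N,
      ~ colon_ring N s &
      forall (r : R) (m : M), homogeneous A r -> homogeneous B m ->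
        N (r *: m) -> colon_ring N (s * r) \/ N (s *: m) ].

(* Defined in the literature only for nonzero homogeneous [s]; that requirement
   is part of membership here, so the set is empty for any other [s]. *)
Definition GSpec (G : groupType) (R : comNzRingType) (M : lmodType R)
    (A : G -> set R) (B : G -> set M) (s : R) : set (set M) :=
  [set N | nz_homogeneous A s /\ graded_s_prime A B s N].

Record mult_set (R : comNzRingType) := MultSet {
  mult_set_car :> set R;
  mult_set0 : ~ mult_set_car 0;
  mult_set1 : mult_set_car 1;
  mult_setM : forall s t,
    mult_set_car s -> mult_set_car t -> mult_set_car (s * t)
}.

Section Denominators.
Variables (R : comNzRingType) (S : mult_set R).

Definition den1 : S := SigSub (mem_set (@mult_set1 R S)).

Definition denM (s t : S) : S :=
  SigSub (mem_set (mult_setM (set_valP s) (set_valP t))).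

Lemma denME (s t : S) : val (denM s t) = val s * val t.
Proof. by []. Qed.

Lemma den1E : val den1 = 1.
Proof. by []. Qed.

End Denominators.

Section ModuleLocalization.
Variables (R : comNzRingType) (S : mult_set R) (M : lmodType R).

(* The factor [u] accounts for zero divisors in [S] and torsion in [M]. *)
Definition loc_equiv (x y : M * S) : bool :=
  `[< exists u : S,
        val u *: (val y.2 *: x.1) = val u *: (val x.2 *: y.1) >].

Lemma loc_equiv_refl : reflexive loc_equiv.
Proof. by move=> x; apply/asboolP; exists (den1 S). Qed.

Lemma loc_equiv_sym : symmetric loc_equiv.
Proof.
by move=> x y; apply/asboolP/asboolP => -[u eu]; exists u; rewrite eu.
Qed.

Lemma loc_equiv_trans : transitive loc_equiv.
Proof.
move=> [m s] [n t] [p w] /asboolP[/= u eu] /asboolP[/= v ev].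
apply/asboolP; exists (denM (denM u v) s) => /=.
move: eu ev; rewrite !scalerA => eu ev.
have -> : val u * val v * val s * val w = (val v * val w) * (val u * val s)
  by ring.
rewrite -scalerA eu scalerA.
have -> : val v * val w * (val u * val t) = (val u * val t) * (val v * val w)
  by ring.
have -> : val u * val v * val s * val t = (val u * val t) * (val v * val s)
  by ring.
by rewrite -[LHS]scalerA -[RHS]scalerA ev.
Qed.

Canonical loc_equiv_rel :=
  EquivRel loc_equiv loc_equiv_refl loc_equiv_sym loc_equiv_trans.

Definition locmod : Type := {eq_quot loc_equiv}.

HB.instance Definition _ : EqQuotient _ loc_equiv locmod :=
  EqQuotient.on locmod.
HB.instance Definition _ := Choice.on locmod.

Definition mfrac (m : M) (s : S) : locmod := \pi_locmod (m, s).

Lemma mfrac_eq (m n : M) (s t : S) :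
  mfrac m s = mfrac n t <->
  exists u : S, val u *: (val t *: m) = val u *: (val s *: n).
Proof. by split => [/eqmodP/asboolP//|?]; apply/eqmodP/asboolP. Qed.

Definition loc_num (x : locmod) : M := (repr x).1.
Definition loc_den (x : locmod) : S := (repr x).2.

Lemma mfrac_num_den (x : locmod) : mfrac (loc_num x) (loc_den x) = x.
Proof. by rewrite /mfrac -surjective_pairing reprK. Qed.

Lemma loc_num_denP (m : M) (s : S) : exists u : S,
  val u *: (val s *: loc_num (mfrac m s)) = val u *: (val (loc_den (mfrac m s)) *: m).
Proof. by apply/mfrac_eq; rewrite mfrac_num_den. Qed.

Definition loc_add (x y : locmod) : locmod :=
  mfrac (val (loc_den y) *: loc_num x + val (loc_den x) *: loc_num y) (denM (loc_den x) (loc_den y)).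
Definition loc_opp (x : locmod) : locmod := mfrac (- loc_num x) (loc_den x).
Definition loc_zero : locmod := mfrac 0 (den1 S).

Lemma loc_addE (m n : M) (s t : S) :
  loc_add (mfrac m s) (mfrac n t) =
  mfrac (val t *: m + val s *: n) (denM s t).
Proof.
have [u] := loc_num_denP m s; have [v] := loc_num_denP n t.
rewrite /loc_add; move: (loc_num (mfrac m s)) (loc_den (mfrac m s)) => m' s'.
move: (loc_num (mfrac n t)) (loc_den (mfrac n t)) => n' t'; rewrite !scalerA => ev eu.
apply/mfrac_eq; exists (denM u v); rewrite !denME !scalerDr !scalerA.
congr (_ + _).
- have -> : val u * val v * (val s * val t) * val t' =
    (val v * val t * val t') * (val u * val s) by ring.
  by rewrite -scalerA eu scalerA; congr (_ *: _); ring.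
- have -> : val u * val v * (val s * val t) * val s' =
    (val u * val s * val s') * (val v * val t) by ring.
  by rewrite -scalerA ev scalerA; congr (_ *: _); ring.
Qed.

Lemma loc_oppE (m : M) (s : S) : loc_opp (mfrac m s) = mfrac (- m) s.
Proof.
have [u eu] := loc_num_denP m s.
by apply/mfrac_eq; exists u; rewrite !scalerN eu.
Qed.

Lemma locP (P : locmod -> Prop) : (forall m s, P (mfrac m s)) -> forall x, P x.
Proof. by move=> Pfrac x; rewrite -(mfrac_num_den x). Qed.

Lemma mfracMl (m : M) (s t : S) : mfrac (val t *: m) (denM t s) = mfrac m s.
Proof.
apply/mfrac_eq; exists (den1 S).
by rewrite !scalerA; congr (_ *: _); rewrite denME; ring.
Qed.

Lemma loc_addA : associative loc_add.
Proof.
elim/locP=> m s; elim/locP=> n t; elim/locP=> p w; rewrite !loc_addE.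
apply/mfrac_eq; exists (den1 S); congr (_ *: _).
rewrite !denME !scalerDr !scalerA !addrA.
by congr (_ + _ + _); congr (_ *: _); ring.
Qed.

Lemma loc_addC : commutative loc_add.
Proof.
elim/locP=> m s; elim/locP=> n t; rewrite !loc_addE.
apply/mfrac_eq; exists (den1 S); congr (_ *: _).
by rewrite !denME addrC (mulrC (val s)).
Qed.

Lemma loc_add0 : left_id loc_zero loc_add.
Proof.
elim/locP=> m s; rewrite loc_addE scaler0 add0r.
exact: mfracMl.
Qed.

Lemma loc_addN : left_inverse loc_zero loc_opp loc_add.
Proof.
elim/locP=> m s; rewrite loc_oppE loc_addE scalerN addNr.
by apply/mfrac_eq; exists (den1 S); rewrite !scaler0.
Qed.

HB.instance Definition _ :=
  GRing.isZmodule.Build locmod loc_addA loc_addC loc_add0 loc_addN.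

Lemma mfrac_add (m n : M) (s t : S) :
  mfrac m s + mfrac n t = mfrac (val t *: m + val s *: n) (denM s t).
Proof. exact: loc_addE. Qed.

Lemma mfrac_opp (m : M) (s : S) : - mfrac m s = mfrac (- m) s.
Proof. exact: loc_oppE. Qed.

Lemma mfrac0 : mfrac 0 (den1 S) = 0.
Proof. by []. Qed.

End ModuleLocalization.

(* The ring S^{-1}R has the additive group of the localization of R as a module
   over itself. *)
Definition locring (R : comNzRingType) (S : mult_set R) : Type :=
  locmod S R^o.

Section RingLocalization.
Variables (R : comNzRingType) (S : mult_set R).

HB.instance Definition _ := GRing.Zmodule.on (locring S).

Definition rfrac (a : R) (s : S) : locring S := @mfrac R S R^o a s.

Lemma rfrac_eq (a b : R) (s t : S) :
  rfrac a s = rfrac b t <->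
  exists u : S, val u * (val t * a) = val u * (val s * b).
Proof. exact: mfrac_eq. Qed.

Lemma rlocP (P : locring S -> Prop) :
  (forall a s, P (rfrac a s)) -> forall x, P x.
Proof. exact: (@locP R S R^o). Qed.

Lemma rfrac_add (a b : R) (s t : S) :
  rfrac a s + rfrac b t = rfrac (val t * a + val s * b) (denM s t).
Proof. exact: mfrac_add. Qed.

Section Action.
Variable M : lmodType R.

Definition loc_scale (x : locring S) (y : locmod S M) : locmod S M :=
  mfrac ((loc_num x : R) *: loc_num y) (denM (loc_den x) (loc_den y)).

Lemma loc_scaleE (a : R) (m : M) (s t : S) :
  loc_scale (rfrac a s) (mfrac m t) = mfrac (a *: m) (denM s t).
Proof.
have [u] := @loc_num_denP R S R^o a s; have [v] := loc_num_denP m t.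
rewrite /loc_scale -/(rfrac a s).
move: (loc_num (rfrac a s)) (loc_den (rfrac a s)) => a' s'.
move: (loc_num (mfrac m t)) (loc_den (mfrac m t)) => m' t'; rewrite !scalerA => ev eu.
have {}eu : val u * val s * a' = val u * val s' * a
  by exact: eu.
apply/mfrac_eq; exists (denM u v); rewrite !denME !scalerA.
have -> : val u * val v * (val s * val t) * a' =
  (val u * val s * a') * (val v * val t) by ring.
rewrite eu -scalerA ev scalerA; congr (_ *: _); ring.
Qed.

End Action.

Definition loc_mul (x y : locring S) : locring S := @loc_scale R^o x y.
Definition loc_one : locring S := rfrac 1 (den1 S).

Lemma loc_mulE (a b : R) (s t : S) :
  loc_mul (rfrac a s) (rfrac b t) = rfrac (a * b) (denM s t).
Proof. exact: loc_scaleE. Qed.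

Lemma loc_mulA : associative loc_mul.
Proof.
elim/rlocP=> a s; elim/rlocP=> b t; elim/rlocP=> c w; rewrite !loc_mulE.
by apply/rfrac_eq; exists (den1 S); rewrite !denME; ring.
Qed.

Lemma loc_mulC : commutative loc_mul.
Proof.
elim/rlocP=> a s; elim/rlocP=> b t; rewrite !loc_mulE.
by apply/rfrac_eq; exists (den1 S); rewrite !denME; ring.
Qed.

Lemma loc_mul1 : left_id loc_one loc_mul.
Proof.
elim/rlocP=> a s; rewrite loc_mulE.
by apply/rfrac_eq; exists (den1 S); rewrite !denME ?den1E; ring.
Qed.

Lemma loc_mulD : left_distributive loc_mul +%R.
Proof.
elim/rlocP=> a s; elim/rlocP=> b t; elim/rlocP=> c w.
rewrite [rfrac a s + _]rfrac_add !loc_mulE rfrac_add.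
by apply/rfrac_eq; exists (den1 S); rewrite !denME ?den1E; ring.
Qed.

Lemma loc_one_neq0 : loc_one != 0.
Proof.
apply/eqP => /rfrac_eq[u]; rewrite den1E !mul1r mulr1 mulr0 => u0.
by apply: (@mult_set0 R S); rewrite -u0; exact: set_valP.
Qed.

HB.instance Definition _ := GRing.Zmodule_isComNzRing.Build (locring S)
  loc_mulA loc_mulC loc_mul1 loc_mulD loc_one_neq0.

Lemma rfrac_mul (a b : R) (s t : S) :
  rfrac a s * rfrac b t = rfrac (a * b) (denM s t).
Proof. exact: loc_mulE. Qed.

Variable M : lmodType R.

Lemma loc_scaleA (x y : locring S) (z : locmod S M) :
  loc_scale x (loc_scale y z) = loc_scale (x * y) z.
Proof.
elim/rlocP: x => a s; elim/rlocP: y => b t; elim/locP: z => m w.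
rewrite rfrac_mul !loc_scaleE.
apply/mfrac_eq; exists (den1 S); rewrite !denME !scalerA.
by congr (_ *: _); ring.
Qed.

Lemma loc_scale1 : left_id 1 (@loc_scale M).
Proof.
elim/locP=> m s; rewrite -[1]/(rfrac 1 (den1 S)) loc_scaleE.
exact: (mfracMl m s (den1 S)).
Qed.

Lemma loc_scaleDr : right_distributive (@loc_scale M) +%R.
Proof.
elim/rlocP=> a s; elim/locP=> m t; elim/locP=> n w.
rewrite [mfrac m t + _]mfrac_add !loc_scaleE mfrac_add.
apply/mfrac_eq; exists (den1 S); rewrite !denME !scalerDr !scalerA.
by congr (_ *: _ + _ *: _); ring.
Qed.

Lemma loc_scaleDl (z : locmod S M) :
  {morph (@loc_scale M)^~ z : x y / x + y}.
Proof.
elim/rlocP=> a s; elim/rlocP=> b t; elim/locP: z => m w.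
rewrite rfrac_add !loc_scaleE !mfrac_add.
apply/mfrac_eq; exists (den1 S); rewrite !denME !scalerDr !scalerA -!scalerDl.
by congr (_ *: _); ring.
Qed.

HB.instance Definition _ := GRing.Zmodule_isLmodule.Build (locring S)
  (locmod S M) loc_scaleA loc_scale1 loc_scaleDr loc_scaleDl.

Lemma mfrac_scale (a : R) (m : M) (s t : S) :
  rfrac a s *: mfrac m t = mfrac (a *: m) (denM s t).
Proof. exact: loc_scaleE. Qed.

End RingLocalization.

(* a/s has degree g when deg a = deg s * g; no commutativity of [G] assumed. *)
Definition locring_grading (G : groupType) (R : comNzRingType)
    (A : G -> set R) (S : mult_set R) (g : G) : set (locring S) :=
  [set x | exists (h : G) (a : R) (s : S),
    [/\ A h a, A (h * g^-1)%g (val s) & x = rfrac a s] ].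

Definition locmod_grading (G : groupType) (R : comNzRingType) (M : lmodType R)
    (A : G -> set R) (B : G -> set M) (S : mult_set R) (g : G) :
  set (locmod S M) :=
  [set x | exists (h : G) (m : M) (s : S),
    [/\ B h m, A (h * g^-1)%g (val s) & x = mfrac m s] ].

(* S^{-1}N, viewed inside S^{-1}M *)
Definition loc_submodule (R : comNzRingType) (M : lmodType R) (S : mult_set R)
    (N : set M) : set (locmod S M) :=
  [set x | exists (n : M) (s : S), N n /\ x = mfrac n s].

Arguments locring_grading {G R} A S g.
Arguments locmod_grading {G R M} A B S g.
Arguments loc_submodule {R M} S N.

(* Main.v *)
(* If [t m] lies in [N] with [t] in [S], homogeneous [m] and [N] graded
   [s]-prime, then [s m] lies in [N], since [s t] is in [S], which misses
   [(N : M)]; comparing homogeneous components extends this to every [m].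
   Hence [m/w] is in [S^-1 N] exactly when [s m] is in [N], which transports
   the prime condition both ways. *)

Require Import Defs.
From mathcomp Require Import all_boot all_algebra all_fingroup.
From mathcomp Require Import boolp classical_sets cardinality fsbigop.

Set Implicit Arguments.
Unset Strict Implicit.
Unset Printing Implicit Defensive.

Import GRing.Theory.

Local Open Scope classical_set_scope.
Local Open Scope ring_scope.

(** * Finite decompositions in an internal direct sum *)

Section DirectSum.
Variable V : zmodType.

Lemma zmod_closed_setP (N : set V) :
  zmod_closed (mem N) <-> N 0 /\ (forall x y, N x -> N y -> N (x - y)).
Proof.
split=> -[N0 NB]; split; first exact: set_mem N0.
- by move=> x y Nx Ny; apply/set_mem/NB; exact/mem_set.
- exact/mem_set.
- by move=> x y /set_mem Nx /set_mem Ny; apply/mem_set/NB.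
Qed.

Variables (I : choiceType) (N : set V) (A : I -> set V).
Hypothesis dsA : internal_direct_sum N A.

Lemma direct_summand0 g : A g 0.
Proof. by case: dsA => /(_ g)/zmod_closed_setP[]. Qed.

Lemma direct_sum_exists x : N x -> exists (r : seq I) (f : I -> V),
  [/\ uniq r, forall g, A g (f g) & x = \sum_(g <- r) f g].
Proof.
case: dsA => _ _ _ /[apply] -[f [[finf Af ->] _]].
exists (finmap.enum_fset (fset_set (f @^-1` [set~ 0]))), f; split=> //.
rewrite -(fsbig_finite _ f finf).
by apply/esym/fsbig_widen => // g [_ /= /contrapT].
Qed.

(** Extended by 0 outside their lists, both families become finitely supported decompositions of the
    same element of [N], and there is only one such decomposition. *)
Lemma direct_sum_unique (r r' : seq I) (f f' : I -> V) :
  uniq r -> uniq r' -> N (\sum_(g <- r) f g) ->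
  (forall g, g \in r -> A g (f g)) -> (forall g, g \in r' -> A g (f' g)) ->
  \sum_(g <- r) f g = \sum_(g <- r') f' g ->
  forall g, (if g \in r then f g else 0) = (if g \in r' then f' g else 0).
Proof.
pose ext (q : seq I) (e : I -> V) g := if g \in q then e g else 0.
have ext_dec q e : uniq q -> (forall g, g \in q -> A g (e g)) ->
    [/\ finite_set (ext q e @^-1` [set~ 0]), forall g, A g (ext q e g) &
        \sum_(g <- q) e g = \sum_(g \in [set: I]) ext q e g].
  move=> uq Aqe; split.
  - apply: (sub_finite_set (B := [set` q])); last exact: finite_seq.
    by move=> g /=; rewrite /ext; case: ifP.
  - by move=> g; rewrite /ext; case: ifPn => [/Aqe//|_]; exact: direct_summand0.
  - rewrite (eq_big_seq (ext q e)); last by move=> g gq; rewrite /ext gq.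
    rewrite fsbig_seq // (fsbig_widen _ [set: I]) // => g [_ /=].
    by rewrite /ext => /negP/negbTE->.
move=> ur ur' Nx Af Af' eqf g.
case: dsA => _ _ _ /(_ _ Nx)[f0 [_ f0_uniq]].
have := f0_uniq _ (ext_dec _ _ ur Af).
have := ext_dec _ _ ur' Af'; rewrite -eqf => /f0_uniq -> /(congr1 (@^~ g)).
by rewrite /ext.
Qed.

Lemma direct_sum_eq0 (r : seq I) (f : I -> V) :
  uniq r -> (forall g, g \in r -> A g (f g)) -> \sum_(g <- r) f g = 0 ->
  forall g, g \in r -> f g = 0.
Proof.
move=> ur Af f0 g gr.
have N0 : N 0 by case: dsA => _ _ /zmod_closed_setP[].
have := @direct_sum_unique r [::] f f ur isT.
by rewrite f0 big_nil => /(_ N0 Af (fun _ _ => ltac:(done)) erefl g); rewrite gr.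
Qed.

Lemma homogeneous_degree_inj g h x : x != 0 -> A g x -> A h x -> g = h.
Proof.
move=> /eqP x0 Agx Ahx; apply/eqP/negPn/negP => /negbTE gh.
have Nx : N x by case: dsA => _ /(_ g) + _ _; exact.
(* Read as a one-term sum in degree [g] and in degree [h], [x] has [g]-component both [x] and 0. *)
have := @direct_sum_unique [:: g] [:: h] (fun=> x) (fun=> x) isT isT.
rewrite !big_seq1 => /(_ Nx) uniq_gh; apply: x0.
have := uniq_gh _ _ erefl g.
by rewrite !inE eqxx gh; apply=> i; rewrite inE => /eqP->.
Qed.

End DirectSum.

(** This criterion works with list sums only. Uniqueness follows from independence applied to the
    difference of two decompositions, over a list containing both supports. *)
Lemma internal_direct_sum_seq (I : choiceType) (V : zmodType) (N : set V)
    (A : I -> set V) :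
  (forall g, zmod_closed (mem (A g))) -> (forall g, A g `<=` N) ->
  zmod_closed (mem N) ->
  (forall x, N x -> exists (r : seq I) (f : I -> V),
     [/\ uniq r, forall g, A g (f g) & x = \sum_(g <- r) f g]) ->
  (forall (r : seq I) (f : I -> V), uniq r -> (forall g, A g (f g)) ->
     \sum_(g <- r) f g = 0 -> forall g, g \in r -> f g = 0) ->
  internal_direct_sum N A.
Proof.
move=> Azmod AN Nzmod Aex Aindep; split=> // x Nx.
have [r [f [ur Af xE]]] := Aex x Nx.
have suppE (q : seq I) (e : I -> V) :
    uniq q -> e @^-1` [set~ 0] `<=` [set` q] ->
    \sum_(g \in [set: I]) e g = \sum_(g <- q) e g.
  move=> uq eq0; rewrite [RHS]fsbig_seq //; apply/esym/fsbig_widen => // g [_ /= gq].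
  by apply: contrapT => /eq0.
pose f' g := if g \in r then f g else 0.
have supf' : f' @^-1` [set~ 0] `<=` [set` r] by move=> g /=; rewrite /f'; case: ifP.
have Af' g : A g (f' g).
  by rewrite /f'; case: ifP => // _; have /zmod_closed_setP[] := Azmod g.
exists f'; split.
  split=> //; first exact: sub_finite_set supf' (finite_seq r).
  rewrite (suppE r) // xE; apply: eq_big_seq => g gr.
  by rewrite /f' gr.
move=> e [/finite_seqP[q qE] Ae xe]; apply/funext => g.
pose p := undup (r ++ q).
have up : uniq p by exact: undup_uniq.
have supf'p : f' @^-1` [set~ 0] `<=` [set` p].
  by move=> h /supf' /= hr; rewrite mem_undup mem_cat hr.
have supep : e @^-1` [set~ 0] `<=` [set` p].
  by rewrite qE => h /= hq; rewrite mem_undup mem_cat hq orbT.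
have fe0 : \sum_(h <- p) (f' h - e h) = 0.
  rewrite sumrB -!(suppE p) // -xe (suppE r) // xE.
  by apply/eqP; rewrite subr_eq0; apply/eqP/eq_big_seq => h hr; rewrite /f' hr.
have fep := Aindep p _ up (fun h => _) fe0.
have [gp|gp] := boolP (g \in p).
  apply/eqP; rewrite -subr_eq0; apply/eqP/fep => // h.
  by have /zmod_closed_setP[_] := Azmod h; exact.
have /contrapT -> : ~ (f' g <> 0) by move=> /supf'p /= /(negP gp).
by have /contrapT -> : ~ (e g <> 0) by move=> /supep /= /(negP gp).
Qed.

Lemma submod_closed_setP (R : comNzRingType) (M : lmodType R) (N : set M) :
  submod_closed (mem N) <->
  N 0 /\ (forall a u v, N u -> N v -> N (a *: u + v)).
Proof.
split=> -[N0 NL]; split; first exact: set_mem N0.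
- by move=> a x y Nx Ny; apply/set_mem/NL; exact/mem_set.
- exact/mem_set.
- by move=> a x y /set_mem Nx /set_mem Ny; apply/mem_set/NL.
Qed.

Lemma submodZ (R : comNzRingType) (M : lmodType R) (N : set M) (a : R) (m : M) :
  submod_closed (mem N) -> N m -> N (a *: m).
Proof.
by move=> /submod_closed_setP[N0 NL] Nm; rewrite -[_ *: _]addr0; exact: NL.
Qed.

Lemma submod_sum (R : comNzRingType) (M : lmodType R) (N : set M)
    (I : eqType) (r : seq I) (f : I -> M) :
  submod_closed (mem N) -> (forall i, i \in r -> N (f i)) ->
  N (\sum_(i <- r) f i).
Proof.
move=> /submod_closed_setP[N0 NL] Nf; rewrite big_seq.
by elim/big_ind: _ => // x y Nx Ny; rewrite -[x]scale1r; exact: NL.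
Qed.

(** * Fractions and localized submodules *)

Section Localization.
Variables (R : comNzRingType) (M : lmodType R) (S : mult_set R).

Lemma mfrac0E (s : S) : mfrac 0 s = 0 :> locmod S M.
Proof. by rewrite -mfrac0; apply/mfrac_eq; exists (den1 S); rewrite !scaler0. Qed.

Lemma mfracDl (m n : M) (s : S) : mfrac (m + n) s = mfrac m s + mfrac n s.
Proof. by rewrite mfrac_add -scalerDr mfracMl. Qed.

Lemma mfrac_sum (I : Type) (r : seq I) (f : I -> M) (s : S) :
  mfrac (\sum_(i <- r) f i) s = \sum_(i <- r) mfrac (f i) s.
Proof.
apply: (big_morph (fun m => mfrac m s) (id1 := 0)); last exact: mfrac0E.
by move=> m n; exact: mfracDl.
Qed.

Lemma mfrac_eq0 (m : M) (s : S) :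
  mfrac m s = 0 -> exists u : S, val u *: m = 0.
Proof.
rewrite -mfrac0 => /mfrac_eq[u]; rewrite den1E scale1r !scaler0.
by exists u.
Qed.

(** If [m/s = n/t] with [n] in [N], some [u] gives [u t m = u s n], which lies in [N]. Conversely,
    [m/s = (u m)/(u s)]. *)
Lemma loc_submodule_mfrac (N : set M) (m : M) (s : S) : submod_closed (mem N) ->
  loc_submodule S N (mfrac m s) <-> exists u : S, N (val u *: m).
Proof.
move=> smN; split=> [[n [t [Nn /mfrac_eq[u eu]]]]|[u Num]].
  exists (denM u t); rewrite denME -scalerA eu.
  by apply: submodZ => //; exact: submodZ.
by exists (val u *: m), (denM u s); rewrite mfracMl.
Qed.

Lemma loc_submodule_submod (N : set M) :
  submod_closed (mem N) -> submod_closed (mem (loc_submodule S N)).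
Proof.
move=> smN; have /submod_closed_setP[N0 NL] := smN.
apply/submod_closed_setP; split; first by exists 0, (den1 S).
elim/rlocP=> a s _ _ [m [t [Nm ->]]] [n [w [Nn ->]]].
rewrite mfrac_scale mfrac_add.
eexists; eexists; split; last reflexivity.
by apply: NL; [exact: submodZ | exact: submodZ].
Qed.

End Localization.

Lemma homogeneous_mul (G : groupType) (R : comNzRingType) (A : G -> set R)
    (a b : R) : graded_ring A ->
  homogeneous A a -> homogeneous A b -> homogeneous A (a * b).
Proof. by move=> [_ AM] [g _ Ag] [h _ Ah]; exists (g * h)%g => //; exact: AM. Qed.

(** * Homogeneous components in graded modules *)

Section GradedModule.
Variables (G : groupType) (R : comNzRingType) (A : G -> set R).
Variables (M : lmodType R) (B : G -> set M) (hB : graded_module A B).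

Let dsB : internal_direct_sum [set: M] B := hB.1.
Let AB g h r m : A g r -> B h m -> B (g * h)%g (r *: m) := @hB.2 g h r m.

(** A decomposition inside [N] is also one inside [M], so uniqueness in [M] identifies it with the
    given one. *)
Lemma graded_submodule_component (N : set M) (r : seq G) (f : G -> M) :
  graded_submodule B N -> uniq r -> (forall g, g \in r -> B g (f g)) ->
  N (\sum_(g <- r) f g) -> forall g, g \in r -> N (f g).
Proof.
move=> [/submod_closed_setP[N0 _] dsN] ur Bf Nf g gr.
have [q [e [uq NBe fe]]] := direct_sum_exists dsN Nf.
have := direct_sum_unique dsB ur uq I Bf (fun h _ => (NBe h).2) fe g.
by rewrite gr => ->; case: ifP => // _; case: (NBe g).
Qed.

Lemma graded_submodule_componentZ (N : set M) (k : G) (t : R) (r : seq G)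
    (f : G -> M) :
  graded_submodule B N -> A k t -> uniq r ->
  (forall g, g \in r -> B g (f g)) ->
  N (t *: \sum_(g <- r) f g) -> forall g, g \in r -> N (t *: f g).
Proof.
move=> gN Akt ur Bf Ntf g gr.
(* Left translation by [k] is injective, so the [t *: f h] lie in distinct degrees [k * h] and are
   the components of the scaled sum. *)
have := @graded_submodule_component N [seq k * h | h <- r]%g
  (fun h => t *: f (k^-1 * h)%g) gN _ _ _ (k * g)%g.
rewrite mulKg; apply.
- by rewrite map_inj_uniq //; exact: mulgI.
- by move=> _ /mapP[h hr ->]; rewrite mulKg; apply: AB => //; exact: Bf.
- by rewrite big_map; under eq_bigr do rewrite mulKg; rewrite -scaler_sumr.
- by apply/mapP; exists g.
Qed.

(** The shift [l] is there for numerators over a common denominator of degree [l]. *)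
Lemma graded_direct_sum_scale_eq0 (k : G) (t : R) (r : seq G) (l : G)
    (f : G -> M) : A k t -> uniq r -> (forall g, g \in r -> B (l * g)%g (f g)) ->
  t *: \sum_(g <- r) f g = 0 -> forall g, g \in r -> t *: f g = 0.
Proof.
move=> Akt ur Bf tf0 g gr.
have := @direct_sum_eq0 _ _ _ _ dsB [seq k * l * h | h <- r]%g
  (fun h => t *: f ((k * l)^-1 * h)%g) _ _ _ (k * l * g)%g.
rewrite mulKg; apply.
- by rewrite map_inj_uniq //; exact: mulgI.
- by move=> _ /mapP[h hr ->]; rewrite mulKg -mulgA; apply: AB => //; exact: Bf.
- by rewrite big_map; under eq_bigr do rewrite mulKg; rewrite -scaler_sumr.
- by apply/mapP; exists g.
Qed.

(** * The grading of the localization *)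

Variables (S : mult_set R) (hA : graded_ring A) (hS : S `<=` homogeneous A).

Let dsA : internal_direct_sum [set: R] A := hA.1.
Let AM g h a b : A g a -> A h b -> A (g * h)%g (a * b) := @hA.2 g h a b.

Lemma mult_set_neq0 (s : S) : val s != 0.
Proof. by apply/eqP => s0; apply: (@mult_set0 R S); rewrite -s0; exact: set_valP. Qed.

Lemma mult_set_homogeneous (s : S) : exists k, A k (val s).
Proof. by have [k _ Ak] := hS (set_valP s); exists k. Qed.

(** As an element of [S], 1 has some degree [g]; from [1 * 1 = 1] and [1 != 0] follows
    [g * g = g]. *)
Lemma graded_one : A 1%g 1.
Proof.
have [g Ag1] := mult_set_homogeneous (den1 S).
suff g1 : g = 1%g by rewrite -g1.
apply: (mulgI g); rewrite mulg1.
apply: (homogeneous_degree_inj dsA (mult_set_neq0 (den1 S))) => //.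
by rewrite -[val _]mulr1; exact: AM.
Qed.

(* [G] need not be abelian, but [s * t = t * s] is nonzero, so that the degrees
   of the denominators commute. *)
Lemma mult_set_degreeC (s t : S) (k l : G) :
  A k (val s) -> A l (val t) -> (k * l)%g = (l * k)%g.
Proof.
move=> Ak Al; apply: (homogeneous_degree_inj dsA (mult_set_neq0 (denM s t))).
  exact: AM.
by rewrite denME mulrC; exact: AM.
Qed.

Lemma locmod_gradingP (g : G) (x : locmod S M) :
  locmod_grading A B S g x <->
  exists (k : G) (m : M) (s : S),
    [/\ A k (val s), B (k * g)%g m & x = mfrac m s].
Proof.
split=> [[h [m [s [Bm As ->]]]]|[k [m [s [As Bm ->]]]]].
  by exists (h * g^-1)%g, m, s; rewrite mulgVK.
by exists (k * g)%g, m, s; rewrite mulgK.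
Qed.

Lemma loc_common_denominator (r : seq G) (x : G -> locmod S M) :
  (forall g, locmod_grading A B S g (x g)) ->
  exists (k : G) (t : S) (f : G -> M), A k (val t) /\
    forall g, g \in r -> B (k * g)%g (f g) /\ x g = mfrac (f g) t.
Proof.
move=> xgr; elim: r => [|h r [k [t [f [Ak IH]]]]].
  by have [k Ak] := mult_set_homogeneous (den1 S); exists k, (den1 S), (fun=> 0).
have [l [m [s [Al Bm xh]]]] := (locmod_gradingP _ _).1 (xgr h).
exists (l * k)%g, (denM s t), (fun g => if g == h then val t *: m else val s *: f g).
split=> [|g]; first exact: AM.
(* The new numerator [t m] has degree [k * (l * h)], but [(l * k) * h] is required: here the degrees
   of the denominators have to commute. *)
rewrite inE; case: eqP => [-> _|_ /= gr].
  rewrite -(mult_set_degreeC Ak Al) -mulgA; split; first exact: AB.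
  rewrite xh -(mfracMl m s t); congr mfrac.
  by apply: val_inj; rewrite /= mulrC.
have [Bf ->] := IH g gr; rewrite mfracMl; split=> //.
by rewrite -mulgA; exact: AB.
Qed.

Lemma locmod_grading_zmod (g : G) : zmod_closed (mem (locmod_grading A B S g)).
Proof.
apply/zmod_closed_setP; split.
  apply/locmod_gradingP; exists 1%g, 0, (den1 S); split=> //; first exact: graded_one.
  exact: (direct_summand0 dsB).
move=> _ _ /locmod_gradingP[k [m [s [As Bm ->]]]]
  /locmod_gradingP[l [n [t [At Bn ->]]]].
rewrite mfrac_opp mfrac_add; apply/locmod_gradingP; exists (k * l)%g.
eexists; eexists; split; last reflexivity; first exact: AM.
have /zmod_closed_setP[_ BB] : zmod_closed (mem (B (k * l * g)%g)).
  by case: dsB.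
rewrite scalerN; apply: BB; last by rewrite -mulgA; exact: AB.
by rewrite (mult_set_degreeC As At) -mulgA; exact: AB.
Qed.

Lemma loc_submodule_graded (N : set M) : graded_submodule B N ->
  graded_submodule (locmod_grading A B S) (loc_submodule S N).
Proof.
move=> [smN dsN].
have smL : submod_closed (mem (loc_submodule S N)) by exact: loc_submodule_submod.
have zmL : zmod_closed (mem (loc_submodule S N)) by exact: GRing.submod_closedB.
split=> //; apply: internal_direct_sum_seq => //.
- move=> g; have /zmod_closed_setP[L0 LB] := zmL.
  have /zmod_closed_setP[g0 gB] := locmod_grading_zmod g.
  apply/zmod_closed_setP; split=> // x y [Lx gx] [Ly gy].
  by split; [exact: LB | exact: gB].
- move=> _ [n [s [Nn ->]]].
  have [k Ak] := mult_set_homogeneous s.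
  have [r [f [ur NBf ->]]] := direct_sum_exists dsN Nn.
  (* Dividing by [s] of degree [k] moves the component of degree [h] to degree [k^-1 * h]. *)
  exists [seq k^-1 * h | h <- r]%g, (fun g => mfrac (f (k * g)%g) s); split.
  + by rewrite map_inj_uniq //; exact: mulgI.
  + move=> g; have [Nf Bf] := NBf (k * g)%g; split; first by exists (f (k * g)%g), s.
    by apply/locmod_gradingP; exists k, (f (k * g)%g), s.
  + by rewrite mfrac_sum big_map; under [RHS]eq_bigr do rewrite mulVKg.
- move=> r x ur Lx x0 g gr.
  (* Over a common denominator, a vanishing sum of fractions means that some [u] in [S] kills the
     sum of the numerators. As [u] is homogeneous, it kills each numerator, so each fraction is
     0. *)
  have [k [t [f [Ak xf]]]] := loc_common_denominator r (fun g => (Lx g).2).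
  have : mfrac (\sum_(g <- r) f g) t = 0.
    by rewrite mfrac_sum -[RHS]x0; apply: eq_big_seq => h /xf[_ ->].
  move=> /mfrac_eq0[u uf0]; have [l Al] := mult_set_homogeneous u.
  have uf := graded_direct_sum_scale_eq0 Al ur (fun h hr => (xf h hr).1) uf0 gr.
  have [_ ->] := xf g gr.
  by rewrite -(mfracMl (f g) t u) uf mfrac0E.
Qed.

End GradedModule.

Theorem proposition3p9 (G : groupType) (R : comNzRingType) (A : G -> set R)
    (hA : graded_ring A) (M : lmodType R) (B : G -> set M)
    (hB : graded_module A B) (fgM : finitely_generated M)
    (S : mult_set R) (hS : S `<=` homogeneous A)
    (N : set M) (hN : graded_submodule B N)
    (hNS : colon_ring N `&` S = set0) (s : R) (hs : (S : set R) s) :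
  GSpec A B s N <->
    graded_prime (locring_grading A S) (locmod_grading A B S)
      (loc_submodule S N) /\
    (forall t : R, (S : set R) t -> colon_mod N t `<=` colon_mod N s).
Proof.
have smN := hN.1.
have colonS t : (S : set R) t -> ~ colon_ring N t.
  by move=> St Nt; have : (colon_ring N `&` S) t by []; rewrite hNS.
have hSu (u : S) : homogeneous A (val u) by exact: hS (set_valP u).
pose s' : S := SigSub (mem_set hs).
have lgN : graded_submodule (locmod_grading A B S) (loc_submodule S N).
  exact: loc_submodule_graded.
split=> [[_ [_ sN primeN]]|[[_ _ primeL] colonN]].
  have torsion (t : R) (m : M) : (S : set R) t -> homogeneous B m ->
      N (t *: m) -> N (s *: m).
    move=> St Bm /(primeN _ _ (hS _ St) Bm)[|//].
    by move=> /colonS[]; exact: mult_setM.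
  have colonN t : (S : set R) t -> colon_mod N t `<=` colon_mod N s.
    move=> St m /= Ntm; have [k _ At] := hS _ St.
    have [r [f [ur Bf mE]]] := direct_sum_exists hB.1 (I : [set: M] m).
    move: Ntm; rewrite /colon_mod /= mE => Ntm.
    rewrite scaler_sumr; apply: submod_sum => // g gr.
    apply: torsion St _ _; first by exists g.
    exact: (graded_submodule_componentZ hB hN At ur (fun h _ => Bf h) Ntm).
  split=> //; split=> //.
    (* If [S^-1 N] were everything, each [m/1] would give [u m] in [N] for some [u] in [S], hence
       [s m] in [N], putting [s] in [(N : M)]. *)
    apply/eqP => LT; apply: sN => m.
    have : loc_submodule S N (mfrac m (den1 S)) by rewrite LT.
    by move=> /(loc_submodule_mfrac _ _ smN)[u /(colonN _ (set_valP u))].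
  move=> _ _ [g _ [h [a [t [Aa _ ->]]]]] [g' _ [h' [m [w [Bm _ ->]]]]].
  rewrite mfrac_scale => /(loc_submodule_mfrac _ _ smN)[u].
  (* The clearing factor [u] is absorbed into the scalar: [u a] is still homogeneous, so the
     [s]-prime condition applies to [u a] and [m]. *)
  rewrite scalerA => /primeN[||Nsua|Nsm].
  - by apply: homogeneous_mul => //; exists h.
  - by exists h'.
  - left; elim/locP=> n v; rewrite mfrac_scale.
    (* Since [s u a] sends [M] into [N], the factor [s u] clears every fraction with numerator
       [a n]. *)
    apply/(loc_submodule_mfrac _ _ smN); exists (denM s' u).
    by rewrite scalerA denME -mulrA; exact: Nsua.
  - by right; apply/(loc_submodule_mfrac _ _ smN); exists s'.
split; first by split; [exact: hS | exact/eqP/(mult_set_neq0 s')].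
split=> //; first exact: colonS.
move=> r m [g _ Ar] [h _ Bm] Nrm.
(* As 1 has trivial degree, [r/1] and [m/1] keep the degrees of [r] and [m], and primeness of
   [S^-1 N] applies to them. *)
have gr1 : A 1%g 1 := graded_one hA hS.
have := primeL (rfrac r (den1 S)) (mfrac m (den1 S)).
case.
- by exists g => //; exists g, r, (den1 S); rewrite mulgV.
- by exists h => //; exists h, m, (den1 S); rewrite mulgV.
- by rewrite mfrac_scale; exists (r *: m); exists (denM (den1 S) (den1 S)).
(* The factor [u] clearing [(r n)/1] depends on [n]; the inclusion of [(N : u)] in [(N : s)]
   replaces it by the uniform [s]. *)
- move=> Lr; left=> n; rewrite -scalerA.
  have := Lr (mfrac n (den1 S)); rewrite mfrac_scale.
  by move=> /(loc_submodule_mfrac _ _ smN)[u /(colonN _ (set_valP u))].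
- by move=> /(loc_submodule_mfrac _ _ smN)[u /(colonN _ (set_valP u))]; right.
Qed.
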